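(* Every 3-connected cubic graph of path-width 4 has a 3-decomposition.
   Context: All graphs are finite and simple; cubic means 3-regular. A 3-decomposition of a graph $G$ is a partition of $E(G)$ into the edge sets of a spanning tree, a (possibly empty) 2-regular subgraph, and a (possibly empty) matching. *)

(* Defs.v *)
From mathcomp Require Import all_boot.
Set Implicit Arguments. Unset Strict Implicit. Unset Printing Implicit Defensive.

Section Graphs.
Variable T : finType.
Implicit Types (e : rel T) (F : {set {set T}}) (S : {set T}).

Definition simple_graph e := symmetric e /\ irreflexive e.

Definition edges e : {set {set T}} := [set [set p.1; p.2] | p in [set q : T * T | e q.1 q.2]].

Definition adjE F : rel T := fun x y => (x != y) && ([set x; y] \in F).

Definition degE F (v : T) : nat := #|[set f in F | v \in f]|.

Definition cubic e := forall v : T, #|[set w | e v w]| = 3.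

Definition k_connected (k : nat) e :=
  k < #|T| /\
  forall S, #|S| < k -> forall x y, x \notin S -> y \notin S ->
    connect [rel u v | e u v && (u \notin S) && (v \notin S)] x y.

Definition path_decomposition e (B : seq {set T}) :=
  [/\ (forall v : T, exists2 X, X \in B & v \in X),
      (forall x y, e x y -> exists2 X, X \in B & (x \in X) && (y \in X)) &
      forall i j k, i < j -> j < k -> k < size B ->
        nth set0 B i :&: nth set0 B k \subset nth set0 B j].

Definition pathwidth_le e (k : nat) :=
  exists2 B, path_decomposition e B & forall X, X \in B -> #|X| <= k.+1.

Definition pathwidth_eq e (k : nat) :=
  pathwidth_le e k /\ forall k', k' < k -> ~ pathwidth_le e k'.

Definition has_cycle F :=
  exists s : seq T, [/\ uniq s, 3 <= size s & cycle (adjE F) s].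

Definition spanning_tree e F :=
  [/\ F \subset edges e, (forall x y : T, connect (adjE F) x y) & ~ has_cycle F].

(* possibly empty 2-regular subgraph: each vertex meets 0 or 2 of its edges *)
Definition two_regular_sub e F :=
  F \subset edges e /\ forall v : T, degE F v = 0 \/ degE F v = 2.

Definition matching e F :=
  F \subset edges e /\ forall v : T, degE F v <= 1.

Definition three_decomposition e :=
  exists Tr C M : {set {set T}},
    [/\ Tr :|: C :|: M = edges e,
        [&& [disjoint Tr & C], [disjoint Tr & M] & [disjoint C & M]],
        spanning_tree e Tr, two_regular_sub e C & matching e M].

End Graphs.

(* Main.v *)
(** A width-4 path decomposition orders the vertices so that every initial
    segment [P] has at most four boundary vertices, i.e. vertices with a
    neighbour outside [P]. What matters about a partial 3-decomposition of the
    graph induced on [P] is its profile on the boundary: which colours each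
    boundary vertex has received so far, and which boundary vertices lie in the
    same tree component. A finite table of states (a residual degree sequence
    together with a set of profiles) was found by computer search such that, if
    all profiles of some state are realized for [P], then after adding any
    admissible next vertex all profiles of some state of the table are realized
    again; every step of this closure is verified by computation. Two facts
    keep the table finite and small. A boundary vertex with a single neighbour
    left may be served at once without enlarging any later boundary, and
    3-connectedness rules out boundaries of one or two vertices once some vertex
    is complete. Proper subsets of the realizable profiles are stored whenever
    they suffice, so that graphs which behave at least as well as a smaller one
    share its state. *)
Require Import Defs.
From Stdlib Require Import Ascii String.
From HB Require Import structures.
From mathcomp Require Import all_boot.
Set Implicit Arguments. Unset Strict Implicit. Unset Printing Implicit Defensive.

(** * Colourings of edge sets *)

Section EdgeSets.
Variable T : finType.
Implicit Types (F : {set {set T}}) (x y a b v : T).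

Lemma set2C x y : [set x; y] = [set y; x].
Proof. exact: setUC. Qed.

Lemma adjE_sym F : symmetric (adjE F).
Proof. by move=> x y; rewrite /adjE eq_sym set2C. Qed.

Lemma connect_adjE_sym F x y : connect (adjE F) x y = connect (adjE F) y x.
Proof. exact: (sym_connect_sym (adjE_sym F)). Qed.

Lemma eq_set2 a b x y : [set a; b] = [set x; y] -> (a = x /\ b = y) \/ (a = y /\ b = x).
Proof.
move=> E.
have: (a \in [set x; y]) && (b \in [set x; y]) by rewrite -E set21 set22.
have: (x \in [set a; b]) && (y \in [set a; b]) by rewrite E set21 set22.
rewrite !inE => /andP[/orP[/eqP->|/eqP->] /orP[/eqP->|/eqP->]]; rewrite ?eqxx ?orbT ?andbT ?orbb.
- by move/eqP->; left.
- by left.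
- by right.
- by move/eqP->; left.
Qed.

Lemma degE_setU1 F f v : f \notin F -> degE (f |: F) v = (v \in f) + degE F v.
Proof.
move=> fF; rewrite /degE; case: (boolP (v \in f)) => vf.
  rewrite (_ : [set _ in _ | _] = f |: [set g in F | v \in g]); last first.
    by apply/setP=> g; rewrite !inE; case: eqP => [->|]; rewrite ?vf.
  by rewrite cardsU1 inE (negPf fF).
apply: eq_card => g; rewrite !inE; case: eqP => [->|//].
by rewrite (negPf vf) (negPf fF).
Qed.

Lemma adjE_setU1 F x y a b : x != y ->
  adjE ([set x; y] |: F) a b = ([set a; b] == [set x; y]) || adjE F a b.
Proof.
move=> xy; rewrite /adjE in_setU1.
case: ([set a; b] =P [set x; y]) => [/eq_set2[[-> ->]|[-> ->]]|]; rewrite ?andbF ?andbT //=.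
by rewrite eq_sym.
Qed.

(** Only one passage over the new edge ever matters: the induction follows the walk edge by edge and
    absorbs repeated crossings. *)
Lemma connect_setU1 F x y a b : x != y ->
  connect (adjE ([set x; y] |: F)) a b =
  [|| connect (adjE F) a b,
      connect (adjE F) a x && connect (adjE F) y b
    | connect (adjE F) a y && connect (adjE F) x b].
Proof.
move=> xy.
have sub: subrel (connect (adjE F)) (connect (adjE ([set x; y] |: F))).
  by apply: connect_sub => u v uv; rewrite connect1 ?adjE_setU1 ?uv ?orbT.
have xyC: connect (adjE ([set x; y] |: F)) x y.
  by rewrite connect1 ?adjE_setU1 ?eqxx.
apply/idP/idP; last first.
  case/or3P => [/sub //|/andP[/sub h1 /sub h2]|/andP[/sub h1 /sub h2]].
    exact: connect_trans h1 (connect_trans xyC h2).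
  by apply: connect_trans h1 (connect_trans _ h2); rewrite connect_adjE_sym.
case/connectP=> p; elim: p a => [|c p IH] a /=; first by move=> _ ->; rewrite connect0.
case/andP=> + pth lst; move: (IH _ pth lst) => {IH pth lst}.
rewrite adjE_setU1 // => IH /orP[/eqP/eq_set2[[ax cy]|[ay cx]]|/connect1 ac]; move: IH; subst.
- case/or3P=> [->|/andP[_ ->]|/andP[_ ->]]; rewrite ?connect0 ?orbT //.
- case/or3P=> [->|/andP[_ ->]|/andP[_ ->]]; rewrite ?connect0 ?orbT //.
- case/or3P=> [h|/andP[h ->]|/andP[h ->]]; rewrite (connect_trans ac h) ?orbT //.
Qed.

(** A cycle through the new edge, with that edge removed, would join [x] and [y] within [F]. *)
Lemma acyclic_setU1 F x y : x != y -> ~~ connect (adjE F) x y ->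
  ~ has_cycle F -> ~ has_cycle ([set x; y] |: F).
Proof.
move=> xy nxy nF [s [us ss cs]].
have [/allP h|/allPn[a sa na]] := boolP (all (fun a => adjE F a (next s a)) s).
  by apply: nF; exists s; split => //; exact: cycle_from_next.
have := next_cycle cs sa; rewrite adjE_setU1 // (negPf na) orbF => /eqP eab.
(* The cycle is rotated to start at [a], so that its first edge, from [a] to [b], is the new one.
   What remains leads from [b] through [c] back to [a]. *)
have [i q eq] := rot_to sa; have us0 := us.
move: cs us ss na eab; rewrite -(rot_cycle i) -(rot_uniq i) -(size_rot i) => cs us ss.
rewrite -(next_rot i us0).
move: cs us ss; rewrite {}eq; case: q => [|b [|c q]] //=; rewrite eqxx.
case/and3P=> _ bc pq; rewrite !inE !negb_or => /and3P[/and3P[ab ac aq] /andP[bc' bq] _] _ nab eab.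
have: connect (adjE F) b a.
  apply: (@connect_trans _ _ c).
    move: bc; rewrite adjE_setU1 // => /orP[|/connect1//].
    rewrite -eab => /eqP/eq_set2[[E _]|[_ E]]; first by rewrite E eqxx in ab.
    by rewrite E eqxx in ac.
  (* The walk from [c] to [a] avoids [b], hence cannot use the edge between [a] and [b]. *)
  apply/connectP; exists (rcons q a); last by rewrite last_rcons.
  apply: (sub_in_path (P := [pred z | z != b])) pq; last first.
    rewrite /= eq_sym bc' all_rcons /= ab; apply/allP=> z zq /=.
    by apply: contraNneq bq => <-.
  move=> u v; rewrite !inE => ub vb; rewrite adjE_setU1 // -eab => /orP[/eqP|//].
  by case/eq_set2=> [[_ E]|[E _]]; [rewrite E eqxx in vb | rewrite E eqxx in ub].
case/eq_set2: eab => [[-> ->]|[-> ->]]; rewrite ?(negPf nxy) // connect_adjE_sym.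
by rewrite (negPf nxy).
Qed.

Lemma connect_isolated F w v : (forall f, f \in F -> w \notin f) ->
  connect (adjE F) w v = (w == v).
Proof.
move=> h; apply/idP/eqP=> [/connectP[[|u p] /=]|-> //]; first by move=> _ ->.
by case/andP=> /andP[_ /h]; rewrite set21.
Qed.

End EdgeSets.

(** * The automaton *)

Inductive color := Tree | Cyc | Mat.

(* A status stands for a set of possible triples (tree, cycle, matching degree)
   of a vertex, namely those [status_ok] accepts: the digit is the number of
   coloured edges at the vertex. Triples with the same possible completions share
   a status, and a triple with more completions also satisfies the status of one
   with fewer: this is what [weaker_status] compares. *)
Inductive status := S0 | S1t | S1c | S1tm | S2t | S2any | S2tc | S3.

Definition statuses := [:: S0; S1t; S1c; S1tm; S2t; S2any; S2tc; S3].

Definition nat_of_status (c : status) : nat :=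
  match c with
  | S0 => 0 | S1t => 1 | S1c => 2 | S1tm => 3 | S2t => 4 | S2any => 5 | S2tc => 6 | S3 => 7
  end.

Lemma nat_of_statusK : cancel nat_of_status (nth S0 statuses).
Proof. by case. Qed.

HB.instance Definition _ := Equality.copy status (can_type nat_of_statusK).

Definition status_ok (c : status) (dt dc dm : nat) : bool :=
  match c, dt, dc, dm with
  | S0, 0, 0, 0
  | S1t, 1, 0, 0
  | S1c, 0, 1, 0
  | S1tm, 1, 0, 0 | S1tm, 0, 0, 1
  | S2t, 2, 0, 0
  | S2any, 2, 0, 0 | S2any, 1, 0, 1 | S2any, 0, 2, 0
  | S2tc, 1, 1, 0
  | S3, 3, 0, 0 | S3, 2, 0, 1 | S3, 1, 2, 0 => true
  | _, _, _, _ => false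
  end.

(** A colour is allowed only if every triple behind the status can still be completed afterwards;
    thus [S1tm] admits only [Tree]. *)
Definition paint_status (c : status) (x : color) : option status :=
  match c, x with
  | S0, Tree => Some S1t
  | S0, Cyc => Some S1c
  | S0, Mat => Some S1tm
  | S1t, Tree => Some S2t
  | S1t, Mat => Some S2any
  | S1t, Cyc => Some S2tc
  | S1c, Tree => Some S2tc
  | S1c, Cyc => Some S2any
  | S1tm, Tree => Some S2any
  | S2t, Tree | S2t, Mat => Some S3
  | S2any, Tree => Some S3
  | S2tc, Cyc => Some S3
  | _, _ => None
  end.

Definition weaker_status (c d : status) : bool :=
  match c, d with
  | S0, S0 | S1t, S1t | S1c, S1c | S1tm, S1tm | S1tm, S1t
  | S2t, S2t | S2any, S2any | S2any, S2t | S2tc, S2tc | S3, S3 => true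
  | _, _ => false
  end.

Lemma paint_status_ok c x c' dt dc dm :
  paint_status c x = Some c' -> status_ok c dt dc dm ->
  match x with
  | Tree => status_ok c' dt.+1 dc dm
  | Cyc => status_ok c' dt dc.+1 dm
  | Mat => status_ok c' dt dc dm.+1
  end.
Proof. by case: c x dt dc dm => [] [] // [|[|[|?]]] [|[|?]] [|[|?]] //= [<-]. Qed.

Lemma weaker_status_ok c d dt dc dm :
  weaker_status c d -> status_ok d dt dc dm -> status_ok c dt dc dm.
Proof. by case: c d dt dc dm => [] [] // [|[|[|?]]] [|[|?]] [|[|?]]. Qed.

(* One entry per boundary vertex: its status and a label, equal for two vertices
   iff they lie in the same component of the partial tree. *)
Definition profile := seq (status * nat).
Definition dflt : status * nat := (S0, 0).

(** The new vertex is a tree component of its own; shifting the old labels frees the label 0 for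
    it. *)
Definition fresh (t : profile) : profile := (S0, 0) :: [seq (p.1, p.2.+1) | p <- t].

(* Colours the edge from the new vertex, at position 0, to the one at position [i]. *)
Definition paint (i : nat) (t : profile) (x : color) : seq profile :=
  let p := nth dflt t 0 in
  let q := nth dflt t i in
  match paint_status p.1 x, paint_status q.1 x with
  | Some c, Some d =>
    let t' := set_nth dflt (set_nth dflt t 0 (c, p.2)) i (d, q.2) in
    if x is Tree then
      if p.2 == q.2 then [::]
      else [:: [seq (r.1, if r.2 == q.2 then p.2 else r.2) | r <- t']]
    else [:: t']
  | _, _ => [::]
  end.

Definition paint_all (ts : seq profile) (i : nat) : seq profile :=
  flatten [seq paint i t Tree ++ paint i t Cyc ++ paint i t Mat | t <- ts].

(* Drops the vertices outside the mask [k]. Every tree component has to meet the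
   new boundary, unless that is empty and the tree is already connected. *)
Definition forget (k : bitseq) (t : profile) : seq profile :=
  let t' := mask k t in
  if all (fun p => if p.1 is S3 then true else false) (mask (map negb k) t) &&
     (if nilp t' then constant [seq p.2 | p <- t]
      else all (fun p => has (fun q => q.2 == p.2) t') t)
  then [:: t'] else [::].

(** Position 0 belongs to the new vertex, so the old boundary is numbered from 1. *)
Definition positions (m : bitseq) : seq nat := mask m (iota 1 (size m)).

(* A signature lists, for each boundary vertex, the number of its neighbours yet
   to come; the mask [m] marks the boundary vertices adjacent to the new one. *)
Definition new_sig (sig : seq nat) (m : bitseq) : seq nat :=
  (3 - count id m) :: [seq p.1 - (p.2 : bool) | p <- zip sig m].

Definition kept (sig : seq nat) (m : bitseq) : bitseq := [seq 0 < r | r <- new_sig sig m].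

Definition step_sig sig m := mask (kept sig m) (new_sig sig m).

Definition step (sig : seq nat) (ts : seq profile) (m : bitseq) : seq profile :=
  flatten [seq forget (kept sig m) t
          | t <- foldl paint_all [seq fresh t | t <- ts] (positions m)].

(** Normal form of the labels: each component is named by the first position where it occurs, so
    equal partitions get equal labels. *)
Definition canon (t : profile) : profile :=
  let l := [seq p.2 | p <- t] in [seq (p.1, index p.2 l) | p <- t].

(** Only statuses may be weakened; the partition into tree components has to agree exactly. *)
Definition weaker (t u : profile) : bool :=
  all2 (fun p q => weaker_status p.1 q.1 && (p.2 == q.2)) t u.

Definition rearrange {A} (d : A) (s : seq A) (p : seq nat) : seq A := [seq nth d s i | i <- p].

Definition state := (seq nat * seq profile)%type.

(** Each profile stored in [st] must follow from one in [ts], while [ts] may contain more. Requiring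
    a stored profile rejects hints that point outside the table and guarantees a decomposition at
    the end. *)
Definition covers (st : state) (sig : seq nat) (ts : seq profile) (p : seq nat) : bool :=
  [&& ~~ nilp st.2,
      perm_eq p (iota 0 (size sig)),
      st.1 == rearrange 0 sig p &
      let us := [seq canon (rearrange dflt u p) | u <- ts] in
      all (fun t => has (weaker t) us) st.2].

(* The second condition is the greedy choice of the next vertex: if the first
   boundary vertex has one neighbour left, that neighbour comes next. The last one
   is 3-connectedness: a boundary of size 1 or 2 is impossible unless no vertex of
   the segment is complete, in which case the boundary has just grown. *)
Definition possible (sig : seq nat) (m : bitseq) : bool :=
  let k := size (step_sig sig m) in
  [&& count id m <= 3,
      (head 0 sig == 1) ==> head false m,
      k <= 4 &
      (k == 0) || (2 < k) || (k == (size sig).+1)].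

Fixpoint masks (n : nat) : seq bitseq :=
  if n is n'.+1 then [seq false :: m | m <- masks n'] ++ [seq true :: m | m <- masks n']
  else [:: [::]].

(* A hint names the state covering a successor, and how to permute the boundary. *)
Definition closed_state (tab : seq state) (st : state) (hints : seq (nat * seq nat)) : bool :=
  let ms := filter (possible st.1) (masks (size st.1)) in
  (size ms == size hints) &&
  all (fun mh => covers (nth ([::], [::]) tab mh.2.1)
                  (step_sig st.1 mh.1) (step st.1 st.2 mh.1) mh.2.2)
      (zip ms hints).

(** Here 48 is the character code of the digit 0. A dash adds no digit, so a lone dash reads as the
    empty word. *)
Fixpoint words (acc : seq nat) (s : string) : seq (seq nat) :=
  match s with
  | EmptyString => [:: rev acc]
  | String c s' =>
    if Ascii.eqb c " " then rev acc :: words [::] s'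
    else if Ascii.eqb c "-" then words acc s'
    else words (nat_of_ascii c - 48 :: acc) s'
  end.

Fixpoint read_profile (s : seq nat) : profile :=
  if s is c :: l :: s' then (nth S0 statuses c, l) :: read_profile s' else [::].

Definition read_nat (s : seq nat) : nat := foldl (fun n d => 10 * n + d) 0 s.

Fixpoint read_hints (s : seq (seq nat)) : seq (nat * seq nat) :=
  if s is j :: p :: s' then (read_nat j, p) :: read_hints s' else [::].

Definition read_state (s : string) : state :=
  let w := words [::] s in (head [::] w, [seq read_profile t | t <- behead w]).

(* First strings: the signature, then the profiles, each a sequence of pairs of
   digits (index of the status in [statuses], label). Second strings: for every
   possible mask, in the order of [masks], the number of the covering state and the
   permutation of the boundary. A dash is an empty sequence. *)
Definition table_data : seq (string * string) := [::
("- -",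
 "1 0");
("3 00",
 "3 01 2 01");
("22 2021 3031 1010",
 "25 120 14 201 14 102 4 012");
("33 0001",
 "27 012 25 021 25 012 14 012");
("111 405050 406060 504050 505040 604060 606040",
 "8 120 0 -");
("111 404040 405152 406060 504151",
 "10 210 0 -");
("111 404040 405150 406060 504151 604060",
 "11 210 0 -");
("111 404050 405150 504040 505140 604060",
 "12 120 0 -");
("112 405010 406022 504010 505032 604022 606010",
 "14 102 4 012");
("112 404032 404010 405110 406022 504111 604022",
 "16 102 5 120");
("112 405010 504010 504012 505112 606010",
 "15 102 6 120");
("112 404010 504012 505132 505110 604022 606010",
 "16 120 5 102");
("112 504010 504111 505032 505132 506022",
 "15 120 6 012");
("113 505002 505102",
 "20 102 12 102");
("122 401010 502122 503110 501032 602110 601022",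
 "21 012 8 021 8 012");
("122 401010 401012 503110 503112 602110",
 "22 012 11 021 10 102");
("122 402122 401032 401010 401110 503112 501111 601022",
 "23 012 10 021 8 012");
("122 401010 501012 501110 501112",
 "24 012 10 201 10 102");
("122 401111 502122 503110 503112 501032 501132 501010",
 "22 120 11 201 11 102");
("122 503110 501010 501012 501111 501112",
 "24 102 10 201 10 102");
("123 501002 501102",
 "26 012 15 021 13 012");
("222 202112 201122 301111 102122 103110 101032 101010",
 "125 1230 102 3012 102 2013 39 3021 102 1023 39 3012 39 2013 4 012");
("222 202112 301111 301112 103110 103112 101010 101012",
 "126 1230 106 3012 105 2310 48 2031 105 1320 48 1032 47 0123 4 012");
("222 201122 301112 102122 103112 101032 101010 101110 101111",
 "127 1230 112 3120 107 2301 57 2031 107 1302 57 1032 53 1023 4 012");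
("222 301111 101010 101012 101110 101112",
 "128 2310 115 3210 115 2310 64 3021 114 1203 63 3012 63 2013 4 012");
("223 202102 303102 101002",
 "129 1203 119 0312 116 2013 69 0213 116 1023 69 0123 66 0123 8 012");
("223 101002 101102",
 "130 1203 121 1023 117 2013 74 0231 117 1023 74 0132 67 0123 9 012");
("333 000102",
 "131 0123 129 0312 129 0213 116 0231 129 0123 116 0132 116 0123 21 012");
("1111 40405050 40406060 40504050 40605260 40606040 50405040 50504040 50514242 50505252 50515150 50516160 50606242 60404060 60406242 60504262 60604040 60615150",
 "41 1230 4 012 4 012 4 012");
("1111 40515253 40604060 40614160 40606040 50414141 50404050 50405040 50416161 50515051 50515150 50616051 60404060 60406040 60416140 60505260 60614150",
 "39 2130 4 012 4 012 4 012");
("1111 40404050 40405040 40405253 40406060 50404252 50405242 50514050 50515040 50515252 50516060 60404262 60406242 60604050 60605040",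
 "59 3210 5 102 5 102 7 102");
("1111 40404040 40416161 40514150 40505240 40515253 40614160 40606040 50415141 50514151 50515153 50614161 50616141 60404060 60604053",
 "57 2130 7 102 4 012 4 012");
("1111 40404050 40605260 40606040 50404040 50414150 50415151 50416160 50514040 50515252 60404060 60406040 60406053 60604053",
 "58 1230 7 012 4 012 4 012");
("1111 40404040 40405250 40406060 40604060 40604262 40606053 40606253 50504242 50514141 50514242 50515051 50515251 50516061 50516261 60404262 60604040 60615051",
 "48 1320 4 012 4 012 6 012");
("1111 40404050 40416061 40504040 40514053 40604060 40616041 50414051 50415151 50515141 50515241 50515253 50615161",
 "60 2130 5 201 7 102 7 012");
("1111 40405050 40406060 40504050 40604060 50405040 50504040 50505252 50515051 50515253 50516061 50605262 50616141 60405260 60406040 60506252 60604040 60615051",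
 "39 1320 4 012 4 012 4 012");
("1111 40405040 40415150 40406060 40416160 40504040 40604060 40614160 40606040 50515051 50616151 60405060 60406053 60504060 60604053",
 "40 1320 4 012 4 012 4 012");
("1111 40404040 40406060 40604060 40616041 50415141 50416061 50514041 50515240 60405260 60406040 60614041",
 "40 1230 4 012 7 012 4 012");
("1111 40404040 40414150 40406060 40416160 40515040 40605260 40615260 40606040 50414151 50505252 50515252 50606252 50616252 60404060 60406053 60515060",
 "48 3210 6 012 4 012 4 012");
("1112 40405010 40406023 40505033 40605223 40606010 50404010 50504033 50505212 50515110 50515213 50516123 50606212 60404023 60406013 60505223 60604010 60615110",
 "71 2130 28 2103 8 012 8 012");
("1112 40405010 40505033 40516023 40605023 40616011 50404010 50504033 50515011 50604023 60406010 60514023 60506033 60614011",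
 "69 1203 35 0231 12 012 8 012");
("1112 40406023 40504010 40614123 50404010 50414113 50405033 50416123 50505212 50606212 60505223 60516010 60604010 60614110",
 "73 1230 35 0132 8 012 12 012");
("1112 40405010 40406023 40606010 40606013 50404010 50405033 50415211 50416123 50504033 50505212 50515110 50605223 50615123 50616111 60404023 60514023 60506013 60604010 60604013",
 "75 2103 29 2031 8 012 8 012");
("1112 40405010 40604023 50404010 50414113 50416123 50504033 50515011 50614123 50616011 60406010 60406013 60515023 60605210",
 "73 2130 35 0231 12 012 8 012");
("1112 40405010 40405013 40504010 40504013 40515213 40606010 40606013 50515110 50515113 60416110 60614110",
 "91 2103 30 0312 10 102 10 102");
("1112 40404010 40405210 40504033 40514011 40505233 40516023 40605223 40616011 50414111 50514133 50614123 60514023 60614011",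
 "81 2103 31 2301 12 012 12 012");
("1112 40404033 40404010 40405210 40406023 40504212 40604023 40604223 40606013 50514133 50514111 50515211 50516023 60514023 60604010 60615011",
 "80 2103 32 0213 8 012 9 012");
("1112 40405010 40405013 40504010 40504013 40606013 50505212 50505213 50515011 50515013 50515213 60406010 60406013 60506212 60604010 60604013",
 "79 1230 36 3120 10 102 10 102");
("1112 40404033 40404010 40505210 40606010 50404013 50514133 50514110 50505212 50505213 50614123 50606212 50606213 60404023 60505223 60516010 60516210 60604010 60614110",
 "82 2103 33 3021 8 012 10 012");
("1112 40404010 40514110 40515010 40515210 40606010 40616110 50404033 50416123 50514133 50515033 50515233 50606033 50616133 60404023 60416110 60515023",
 "84 1203 34 1023 12 102 8 012");
("1112 40405010 40405013 40504010 40504013 40606013 50514213 50505212 50505213 50515011 50515013 60406010 60406013 60604010 60614110 60605210",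
 "79 2130 36 3120 10 102 10 102");
("1112 40504010 40504013 40606033 40606010 40606210 40606212 50404010 50404013 50405210 50514133 50514110 50514212 50514213 50614123 50616211 60404023 60406033 60406010 60604013",
 "89 1203 37 3102 8 012 10 012");
("1112 40504010 40606010 40606013 50404010 50404013 50414113 50505212 50505213 50515011 50606212 60516010 60604010 60604013",
 "74 1203 38 2301 10 102 10 102");
("1112 40404010 40406023 40505212 40605223 40606212 50404033 50515113 60505223 60516010 60604010 60615110",
 "69 1230 35 0132 8 012 12 012");
("1112 40405010 40606010 40606013 50404010 50404013 50414113 50515011 50515013 50515110 50616011 60406010 60416110 60605210",
 "74 2103 38 1302 10 102 10 102");
("1112 40404033 40404010 40416123 40515033 40515010 40606033 40606010 50414110 50414113 50515210 60404023 60416110 60515023",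
 "78 1203 30 2103 10 102 8 012");
("1112 40404010 40515210 40606010 50404013 50514133 50514110 50515113 50515213 50606013 60404023 60416110 60614110",
 "88 1203 34 3201 10 102 10 102");
("1112 40404010 40406023 40505013 40505212 40605223 40606013 40606212 50404013 50514133 50514111 50505213 50515213 60406013 60604010 60604013",
 "87 2103 35 0132 8 012 12 012");
("1112 40406023 40505033 40605223 50404010 50405033 50514111 50505212 50606212 60505223 60516010 60604033 60604010",
 "69 1230 35 0132 8 012 12 012");
("1112 40504033 40504010 40505210 40506023 40604223 50404033 50404010 50404212 50405210 50406023 50514212 50505213 60404223 60604010 60605210",
 "76 2103 31 2013 8 012 12 012");
("1112 40405010 40415110 40504010 40606010 50405013 50504013 50514113 50515213 50606013 60416110 60614110",
 "91 2103 30 0312 10 102 10 102");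
("1112 40404010 40515110 40515213 40606010 50404013 50414113 50606013 60406013 60604013",
 "91 2103 30 0312 10 102 10 102");
("1112 40504010 40606010 40606013 50404010 50405013 50514133 50504013 50514011 50514110 50514213 50515013 50515113 60404023 60406010 60406013 60604013",
 "93 1203 34 3201 10 102 10 102");
("1112 40404010 40404013 40505212 40505213 40606010 40606013 40606212 50514113 50515110 60516010 60604010 60604013",
 "74 1203 38 2301 10 102 10 102");
("1112 40404010 40404013 40505210 40505212 40505213 40606010 40606212 40606213 50514111 60516010 60516210 60604010 60614110",
 "74 1203 38 3210 10 102 10 012");
("1112 40405010 40405013 40504010 40504013 40505212 40505213 40515011 40515013 40515213 40606013 60406010 60416110 60516010 60604010 60614110",
 "79 1230 36 3120 10 102 10 102");
("1113 40505003 40606003 50405003 50504003 60406003 60604003",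
 "98 1203 40 1023 13 012 13 012");
("1113 40404003 50405203 50514003 60406003 60604003",
 "99 1203 45 1023 13 012 13 012");
("1113 40404003 40505203 40515203 40606003 40616103 50415103 60604003",
 "100 2103 49 0213 13 012 13 012");
("1122 40401010 40503210 40602210 50401033 50512223 50503233 50511110 50602233 50611123 60401023 60512210 60503223 60611110",
 "102 1203 40 0132 39 1203 4 012 14 012");
("1122 40503210 40501033 40602210 40601023 50412223 50403210 50401033 50401010 50511011 50511110 50511213 50612211 50611123 60402210 60401023 60512210 60511023",
 "103 1023 41 1302 41 1203 4 012 14 012");
("1122 40402223 40401010 40503210 40601023 50401033 50512223 50503233 50501212 50511011 50511213 50612211 50601223 60402210 60401223 60502213 60601010 60611011",
 "103 1203 43 1032 41 1023 4 012 14 012");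
("1122 40502223 40503210 40501033 40501010 40602213 40601223 50402223 50403210 50401033 50401010 50501212 50511212 60402213 60401223 60603210 60601033 60601010",
 "102 1023 39 3012 39 2013 4 012 18 012");
("1122 40401010 40401213 40503210 40602210 40602213 50401033 50512223 50511110 50611123 60402213 60401023 60401223 60611110",
 "102 1203 40 0132 39 1203 4 012 14 012");
("1122 40401010 40401013 50403210 50403213 50511011 50511013 50612211 60402210 60402213 60611011",
 "104 1023 46 3012 44 1023 5 021 15 012");
("1122 40402223 40401010 40501033 40602213 50403210 50401033 50411211 50501212 50601223 60401223 60502213 60601010 60601013 60601210",
 "102 1023 39 3012 39 2013 4 012 19 021");
("1122 40401033 40401010 40411110 40512223 40503233 40503210 40513210 40602210 40611123 50411111 50513211 50511113 50612211 60401023 60503223",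
 "107 1320 49 1032 53 0213 4 012 14 012");
("1122 40401010 40401013 40602210 40602213 50403210 50403213 50501212 50501213 50511110 50511113 50511213 60402213 60601010 60601013",
 "108 1032 48 1032 52 1023 4 012 15 012");
("1122 40402223 40403210 40401033 40401010 40401212 40503213 40501233 40602213 40601223 50512223 50513211 50511133 50511111 50511212 60603210 60601033 60601010",
 "109 1230 53 1032 53 1023 4 012 18 012");
("1122 40501033 40601023 40601223 50401033 50401233 50401010 50401210 50511011 50511110 50511210 50511211 50511213 50611123 60401023 60401223 60601210",
 "110 1023 54 1032 55 1203 7 012 15 021");
("1122 40401033 40401010 40512223 40513210 40501233 40501210 40511110 40602210 40611123 50413211 50411111 50511211 50612211 60401023 60511023 60601013",
 "111 1302 56 1032 58 0213 4 012 14 012");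
("1122 40401010 40401210 40512223 40501033 40501233 40511011 40612211 40601223 50413211 50411111 50513233 50511133 50611123 60511023 60611011",
 "112 1023 57 0312 40 0123 4 012 19 021");
("1122 40402223 40403210 40401010 40401013 40501233 40501212 40602213 40601223 50512223 50513211 50511111 50511113 60512210 60601010 60611110",
 "111 1230 58 3012 58 1023 4 012 19 012");
("1122 40401010 40503213 40501013 40601023 50401233 50401210 50513233 50513211 50511033 50501213 50511011 50612211 50601223 60402210 60502213 60511023 60611011",
 "111 1023 39 1302 56 1203 4 012 17 012");
("1122 40502223 40503210 40501033 40501010 50402223 50403210 50403213 50401033 50401233 50401010 50401212 50513213 50511233 50511212 60603210 60603213 60601033 60601233 60601010 60601212",
 "106 1023 48 3012 48 2013 4 012 18 012");
("1122 40401033 40401010 40501233 40601023 40601223 50413211 50401210 50411011 50511211 50511213 60402210 60401223 60512210 60601210",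
 "107 1032 61 1032 49 1203 7 102 15 021");
("1122 40403210 40401010 40511011 40612211 40603223 40601023 50412223 50403213 50401013 50511113 60402210 60412210 60511023 60601210",
 "102 1302 39 1302 40 0123 4 012 14 012");
("1122 40401010 40401013 40501233 40501210 40602210 40602213 50503213 50511110 50511113 50511213 50611123 60402213 60601013",
 "105 1302 60 1302 47 2013 4 012 15 012");
("1122 40502223 40503210 40501010 40501013 40602213 50402223 50403210 50401233 50401010 50401013 50401212 50501213 50511212 50511213 60402213 60601010 60601013",
 "107 1203 53 1032 57 1023 4 012 18 012");
("1122 40402223 40401010 40401013 40511010 50403210 50403213 50401233 50401212 50411211 50411213 60601033 60601010 60611010 60611011 60611210",
 "106 1023 48 3012 48 2013 4 012 17 012");
("1122 40403210 40401010 40501013 40602210 40602213 50401210 50513210 50511133 50501212 50501213 50511110 50511213 60402213 60401023 60601010 60601013",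
 "113 1230 54 1302 61 1023 4 012 17 012");
("1122 40503210 40501010 40501013 40602213 50403210 50403213 50401010 50401013 50501212 50501213 50511213 60402213 60601010 60601013",
 "105 1320 48 1032 47 0123 4 012 19 012");
("1122 40501010 40501013 40501210 40602213 40601223 50403213 50401233 50401010 50401013 50401210 50501212 50511213 60402213 60401223 60601010 60601013 60601210",
 "112 1230 57 3012 57 2013 4 012 19 012");
("1122 40402223 40401010 40602210 40602213 50403210 50401013 50401212 50411110 50411213 50501213 50511113 60601010 60601013",
 "108 1032 53 1032 52 1023 4 012 15 012");
("1122 40403210 40403213 40401010 40401013 40511011 40511013 40612211 60402210 60402213 60601210",
 "104 1023 46 3012 44 1023 5 012 15 012");
("1122 40403210 40403213 40401010 40401013 40511011 40511013 40612211 60402210 60412210 60601210",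
 "104 1023 46 3012 44 1023 5 012 15 012");
("1122 40501010 40501013 40501210 50401010 50401013 50401210 50401213 50501212 50511213 60601010 60601013 60601210",
 "114 1203 54 1302 54 1203 4 012 19 012");
("1122 40501033 40501010 40501210 50401033 50401010 50401210 50401212 50401213 50511212 50511213 60601010 60601210",
 "115 1230 63 1032 64 1023 4 012 19 021");
("1123 40501003 40602203 50401003 50503203 60402203 60601003",
 "116 1023 69 0123 66 0123 8 012 20 012");
("1123 40403203 40401003 40511003 40602203 50411103 60402203",
 "118 1023 76 1032 68 1203 10 102 20 012");
("1123 40501003 50401003 50401203 50511203 60601003",
 "117 1023 74 0132 67 0123 9 012 20 012");
("1123 40401003 50401203 50513203 50511003 60402203 60601003",
 "118 1203 81 1023 68 1023 12 102 20 012");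
("1222 40102223 40103210 40101033 40101010 50212213 50211223 50312223 50313210 50311033 50311010 50101212 60213210 60211033 60211010 60102213 60101223",
 "120 0123 71 3021 71 2031 8 120 72 0123 8 021 8 012");
("1222 40212210 40211023 40112223 40103210 40101033 50212213 50211223 50313210 50311033 50111011 50111110 50111213 60102210 60112210 60101023 60111023",
 "119 0213 69 0312 69 0213 12 210 69 0123 8 021 8 012");
("1222 40212210 40212213 40311010 40311013 40103210 40103213 40101010 40101013 50111110 50111113 60211210 60112210",
 "122 0312 78 3012 77 0213 10 120 77 0123 10 021 10 102");
("1222 40103210 40113210 40101010 40111010 50112223 50103233 50113233 50101033 50111033 50111110 50111210 60112210 60101023 60111023",
 "122 2103 91 3021 77 2031 10 210 82 1032 10 201 8 012");
("1222 40102223 40103210 40103213 40101033 40101233 40101010 40101212 50312223 50313210 50313213 50311033 50311233 50311010 50311212 60213210 60211033 60211010",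
 "119 0123 83 0312 83 0213 8 120 84 1023 10 201 10 102");
("1222 40211023 40311010 40111033 40101010 40101013 40111011 50212213 50213223 50313210 50103210 50103213 50111013 60211013 60102210 60102213",
 "119 0213 69 0312 88 0213 8 120 87 1023 8 021 10 102");
("1222 40311010 40101033 40101010 50101212 50101213 50111110 50111210 50111213 60211010 60211210 60101023 60101223",
 "121 1023 74 0312 74 0213 8 120 74 0132 10 201 8 012");
("1222 40212210 40311010 40103210 40101010 40111110 50212213 50311233 50311013 50311210 50113233 50103213 50113210 50101013 50111113 60211210 60311023 60112210 60103223 60101023",
 "119 0312 84 3012 87 0213 12 210 87 0123 12 201 8 012");
("1222 40211023 40211223 40101233 50311033 50111011 50111110 50111210 50111211 50111213 60101023 60101223",
 "121 0123 74 3012 74 0231 12 120 74 1032 10 201 9 012");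
("1222 40212210 40311010 40101233 40101010 40101210 50212213 50211223 50311013 50113233 50113210 50111133 50101013 50101213 50111110 60211210 60101023 60101223",
 "119 0312 88 3012 69 0213 8 120 90 1032 10 201 8 012");
("1222 40311210 40113210 40101010 40101210 40111010 50211223 50311233 50112223 50113233 50101033 50101233 50111033 50111110 60211210 60112210 60111023",
 "123 0123 92 0312 91 2031 10 120 91 1032 10 021 8 012");
("1222 40102223 40101033 40111010 50311212 50103213 50101233 50101212 50111110 50111210 50111213 60211010 60211210 60101023 60101223",
 "119 0123 83 0312 74 0231 8 120 74 0132 12 021 9 012");
("1222 40101010 40101013 40111010 40111013 50103210 50103213 50113210 50113213 50111011 60102210 60102213",
 "124 1302 74 0321 96 0213 10 210 74 0123 8 021 10 102");
("1222 40103210 40101010 40111010 40111110 40111210 50103233 50101033 50111033 60101023 60111023",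
 "121 1023 97 0312 74 0231 10 210 74 0132 10 201 8 012");
("1223 40101003 50212203 50311003 50103203 60211003 60102203",
 "125 0123 102 0312 98 0213 14 102 98 0123 14 012 13 012");
("1223 40101003 40101203 50311003 50311203 60211003",
 "126 0123 105 0213 101 0213 16 102 100 0123 15 021 13 012");
("1223 40212203 40103203 40101003 40111003 50311203 50111103 60102203",
 "127 0123 107 0231 100 0213 15 120 98 0123 14 012 13 012");
("2222 20213233 20211212 30312223 30311212 10102223 10103233 10101212",
 "40 2130 40 2031 40 0312 40 0213");
("2222 20213213 20211233 20211212 20112213 20111223 30112223 30113211 30111133 30111111 10212213 10211223 10312223 10313210 10311033 10102223 10103210 10101010 10101212",
 "42 2130 42 2031 42 0312 42 0213");
("2222 10211023 10211223 10311033 10311233 10111011 10111211",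
 "44 2130 45 0321 44 0132 45 0123");
("2222 20112213 20111223 30113211 30113213 30111133 30111233 30111111 10102223 10112223 10103210 10113210 10101033 10111033 10101010 10101212 10111010 10111212",
 "51 3210 50 0231 40 0312 40 0213");
("2222 20211213 20112213 20111223 30311213 30113213 30111111 30111211 30111212 10211223 10311233 10311210 10112223 10113233 10101033 10101233 10111033 10101010 10111110",
 "40 1320 62 3021 62 3012 40 1023");
("2222 10102223 10112223 10113210 10113211 10113213 10101033 10111033 10111133 10111233 10101010 10101212 10111212",
 "65 1320 65 0321 45 0312 40 0213");
("2223 20211203 20112203 30111103 10212203 10311003 10103203 10101003",
 "70 2103 70 2013 70 1023 66 0123");
("2223 20211203 30111103 30111203 10311003 10311203 10101003 10101203",
 "80 2103 80 2013 79 1023 66 0123");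
("2223 20112203 30111203 10212203 10311203 10101003 10111003 10111103",
 "85 2103 85 2013 86 1032 66 0123");
("2223 10101003 10111003 10111103 10111203",
 "94 1230 94 0231 95 1032 66 0123");
("2233 20210203 30310203 10100203",
 "102 1023 102 0123 98 0132 98 0123");
("2233 10100203 10110203",
 "104 1230 104 0231 99 0132 99 0123");
("3333 00010203",
 "125 1230 125 0231 125 0132 125 0123")]%string.

Definition table : seq state := [seq read_state p.1 | p <- table_data].

Definition check_table (tab : seq state) : bool :=
  (head ([::], [::]) tab == ([::], [:: [::]])) &&
  all (fun st => closed_state tab st.1 (read_hints (words [::] st.2)))
      (zip tab (map snd table_data)).

(** The closure of the table under all possible steps, and the fact that its entry 0 describes the
    empty segment, are settled by evaluation. *)
Lemma check_tableT : check_table table.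
Proof. by vm_compute. Qed.

(** * Profiles of partial decompositions *)

Section Partial.
Variable T : finType.
Implicit Types (P : {set T}) (E F : {set {set T}}) (s : seq T) (t u : profile) (g : T -> status * nat).

(** The map [g] decorates all of [P], while [t] records it only along [s]. The last clause makes
    every tree component meet [s], since otherwise it could never be joined to the rest; with [s]
    empty the tree must already be connected. *)
Definition partial P E s t := exists (Tr C M : {set {set T}}) g,
  [/\ [/\ t = map g s, Tr :|: C :|: M = E &
          [&& [disjoint Tr & C], [disjoint Tr & M] & [disjoint C & M]]],
      {in P, forall v, status_ok (g v).1 (degE Tr v) (degE C v) (degE M v)},
      {in P, forall v, v \notin s -> (g v).1 = S3},
      ~ has_cycle Tr /\
      {in P &, forall x y, connect (adjE Tr) x y = ((g x).2 == (g y).2)} &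
      s = [::] /\ {in P &, forall x y, (g x).2 = (g y).2} \/
      {in P, forall v, (g v).2 \in [seq (g x).2 | x <- s]}].

Lemma degE0 F v : (forall f, f \in F -> v \notin f) -> degE F v = 0.
Proof.
move=> h; apply: eq_card0 => f; rewrite !inE; apply/negP=> /andP[/h].
by move/negPf->.
Qed.

(** No edge of [E] meets [w], so all degrees at [w] are 0. The hypothesis on empty [s] excludes a
    finished tree that [w] could never join. *)
Lemma partial_fresh P E s t w :
  partial P E s t -> (s = [::] -> P = set0) -> {subset s <= P} -> w \notin P ->
  (forall f, f \in E -> f \subset P) ->
  partial (w |: P) E (w :: s) (fresh t).
Proof.
case=> Tr [C [M [g [[-> EE dis] gok gS3 [acy lab] anc]]]] s0 sP wP EP.
have wE F : F \subset E -> forall f, f \in F -> w \notin f.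
  by move=> /subsetP FE f /FE /EP /subsetP fP; apply: contra wP => /fP.
have TrE : Tr \subset E by rewrite -EE -setUA subsetUl.
have CE : C \subset E by rewrite -EE -setUA setUCA subsetUl.
have ME : M \subset E by rewrite -EE subsetUr.
have sw : w \notin s by apply: contra wP => /sP.
pose g' v := if v == w then (S0, 0) else ((g v).1, (g v).2.+1).
have g'P v : v \in P -> g' v = ((g v).1, (g v).2.+1).
  by rewrite /g'; case: eqP => // -> wP'; rewrite wP' in wP.
have g'w : g' w = (S0, 0) by rewrite /g' eqxx.
exists Tr, C, M, g'; split.
- split => //; rewrite /fresh /= g'w -map_comp; congr (_ :: _).
  by apply/eq_in_map => v /sP vP /=; rewrite g'P.
- move=> v; rewrite in_setU1 => /orP[/eqP-> | vP]; last by rewrite g'P //; apply: gok.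
  by rewrite g'w !degE0 //; apply: wE.
- move=> v; rewrite in_setU1 inE negb_or => /orP[/eqP-> | vP]; first by rewrite eqxx.
  by case/andP=> _ vs; rewrite g'P //=; apply: gS3.
- split => // x y; rewrite !in_setU1.
  case: (eqVneq x w) => [-> _ | xw /= xP].
    case: (eqVneq y w) => [-> _ | yw /= yP]; first by rewrite connect0 eqxx.
    by rewrite connect_isolated ?g'w ?g'P 1?eq_sym ?(negPf yw) //; apply: wE.
  case: (eqVneq y w) => [-> _ | yw /= yP]; last by rewrite !g'P // lab.
  by rewrite connect_adjE_sym connect_isolated ?g'w ?g'P 1?eq_sym ?(negPf xw) //; apply: wE.
- right=> v; rewrite in_setU1 /= inE => /orP[/eqP-> | vP]; first by rewrite eqxx.
  case: anc => [[sN _]|anc]; first by rewrite s0 ?inE in vP.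
  apply/orP; right; have /mapP[x xs ex] := anc _ vP.
  by apply/mapP; exists x => //; rewrite (g'P v vP) (g'P x (sP _ xs)) /= ex.
Qed.

Lemma disjoint_setU1 (A : finType) (a : A) (X Y : {set A}) :
  [disjoint a |: X & Y] = (a \notin Y) && [disjoint X & Y].
Proof. by rewrite -!setI_eq0 setIUl setU_eq0 setI_eq0 disjoints1. Qed.

Lemma set_nth_map (A : Type) (d y : A) (x0 : T) (f : T -> A) s i : uniq s -> i < size s ->
  set_nth d (map f s) i y = [seq if v == nth x0 s i then y else f v | v <- s].
Proof.
move=> us si; apply: (@eq_from_nth _ d).
  by rewrite size_set_nth !size_map; apply/maxn_idPr.
move=> j; rewrite size_set_nth size_map (maxn_idPr si) => sj.
rewrite nth_set_nth /= !(nth_map x0) // nth_uniq //.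
Qed.

(** Unequal labels mean that the ends lie in different components, so a tree edge closes no cycle
    and merges exactly these two. *)
Lemma partial_paint P E s w i t t' x :
  partial P E (w :: s) t -> t' \in paint i t x -> uniq (w :: s) -> {subset w :: s <= P} ->
  0 < i <= size s -> [set w; nth w (w :: s) i] \notin E ->
  partial P ([set w; nth w (w :: s) i] |: E) (w :: s) t'.
Proof.
case=> Tr [C [M [g [[-> EE dis] gok gS3 [acy lab] anc]]]] + us sP /andP[i0 si].
set u := nth w (w :: s) i; set f := [set w; u] => pt fE.
have ui : u \in w :: s by rewrite mem_nth.
have uw : u != w.
  by rewrite -[X in _ != X]/(nth w (w :: s) 0) nth_uniq //= -lt0n.
have wP : w \in P by apply: sP; rewrite inE eqxx.
have uP : u \in P by apply: sP.
have fTr : f \notin Tr by apply: contra fE; rewrite -EE !inE => ->.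
have fC : f \notin C by apply: contra fE; rewrite -EE !inE => ->; rewrite orbT.
have fM : f \notin M by apply: contra fE; rewrite -EE !inE => ->; rewrite orbT.
move: pt; rewrite /paint.
rewrite !(nth_map w) // -/u [nth w _ 0]/=.
case E1: paint_status => [c|//]; case E2: paint_status => [d|//].
rewrite (set_nth_map _ _ w g (i := 0)) // (set_nth_map _ _ w) //= -/u.
(* [g1] updates the statuses of both ends and keeps all labels; only the [Tree] case has to relabel
   further. *)
pose g1 v := if v == u then (d, (g u).2) else if v == w then (c, (g w).2) else g v.
have g1l v : (g1 v).2 = (g v).2.
  by rewrite /g1; case: eqP => [->//|_]; case: eqP => [->|].
have fv v : v \in f = (v == u) || (v == w) by rewrite !inE orbC.
have g1S3 v : v \in P -> v \notin w :: s -> (g1 v).1 = S3.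
  move=> vP vs; rewrite /g1.
  case: eqP => [vu|_]; first by rewrite vu ui in vs.
  case: eqP => [vw|_]; first by rewrite vw mem_head in vs.
  exact: gS3.
(* The boundary contains [w], so the alternative of an empty boundary is void. *)
have lw : {in P, forall v, (g v).2 \in [seq (g x).2 | x <- w :: s]}.
  by case: anc => [[]|].
have [EuTr EuC EuM] : [/\ (f |: Tr) :|: C :|: M = f |: E,
    Tr :|: (f |: C) :|: M = f |: E & Tr :|: C :|: (f |: M) = f |: E].
  by rewrite -EE; split; apply/setP=> h; rewrite !inE; do !case: (_ \in _); case: eqP.
have [D1 D2 D3] := and3P dis.
have stw := paint_status_ok E1 (gok _ wP); have stu := paint_status_ok E2 (gok _ uP).
case: x E1 E2 stw stu => E1 E2 stw stu.
- case: ifPn => // luw; rewrite inE => /eqP ->.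
  (* The component of [u] takes over the label of [w], also at vertices off the boundary. *)
  pose g2 v := ((g1 v).1, if (g1 v).2 == (g u).2 then (g w).2 else (g1 v).2).
  exists (f |: Tr), C, M, g2; split.
  + split => //; first by rewrite /= -map_comp.
    by rewrite !disjoint_setU1 fC fM /= D1 D2.
  + move=> v vP; rewrite degE_setU1 // fv /g2 /g1 /=.
    case: (eqVneq v u) => [-> //|vu]; case: (eqVneq v w) => [-> //|vw] /=.
    exact: gok.
  + by move=> v vP vs; apply: g1S3.
  + split.
      by apply: acyclic_setU1 => //; rewrite ?lab // eq_sym.
    move=> a b aP bP; rewrite connect_setU1 1?eq_sym // !lab // /g2 /= !g1l.
    move: luw; case: (eqVneq (g a).2 (g u).2) => [->|au]; case: (eqVneq (g b).2 (g u).2) => [->|bu] luw.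
    * by rewrite eqxx.
    * by rewrite andbF eq_sym.
    * by rewrite (negPf au) /= andbT orbF eq_sym.
    * by rewrite !andbF !orbF eq_sym.
  + right=> v /lw /mapP[x xs ex]; apply/mapP; exists x => //.
    by rewrite /g2 /= !g1l ex.
- rewrite inE => /eqP ->; exists Tr, (f |: C), M, g1; split => //.
  + split => //; rewrite disjoint_sym !disjoint_setU1 fTr fM /= D2 D3 !andbT.
    by rewrite disjoint_sym.
  + move=> v vP; rewrite degE_setU1 // fv /g1.
    case: (eqVneq v u) => [-> //|vu]; case: (eqVneq v w) => [-> //|vw] /=.
    exact: gok.
  + by split=> // a b aP bP; rewrite lab // !g1l.
  + by right=> v /lw /mapP[x xs ex]; apply/mapP; exists x; rewrite ?g1l.
- rewrite inE => /eqP ->; exists Tr, C, (f |: M), g1; split => //.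
  + split => //; rewrite ![[disjoint _ & f |: _]]disjoint_sym !disjoint_setU1 fTr fC /= D1.
    by rewrite disjoint_sym D2 disjoint_sym.
  + move=> v vP; rewrite degE_setU1 // fv /g1.
    case: (eqVneq v u) => [-> //|vu]; case: (eqVneq v w) => [-> //|vw] /=.
    exact: gok.
  + by split=> // a b aP bP; rewrite lab // !g1l.
  + by right=> v /lw /mapP[x xs ex]; apply/mapP; exists x; rewrite ?g1l.
Qed.

Lemma partial_paint_all P E s w (ts : seq profile) (l : seq nat) :
  (forall t, t \in ts -> partial P E (w :: s) t) ->
  uniq (w :: s) -> {subset w :: s <= P} ->
  uniq l -> all (fun i => 0 < i <= size s) l ->
  (forall i, i \in l -> [set w; nth w (w :: s) i] \notin E) ->
  forall t, t \in foldl paint_all ts l ->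
  partial P (E :|: [set f in [seq [set w; nth w (w :: s) i] | i <- l]]) (w :: s) t.
Proof.
move=> + us sP; elim: l ts E => [|i l IH] ts E tsE /=.
  move=> _ _ _ t /tsE; rewrite (_ : E :|: _ = E) //.
  by apply/setP=> f; rewrite !inE orbF.
case/andP=> il ul /andP[i_s l_s] lE t tts.
have iE : [set w; nth w (w :: s) i] \notin E by rewrite lE ?mem_head.
rewrite (_ : E :|: _ = ([set w; nth w (w :: s) i] |: E) :|:
    [set f in [seq [set w; nth w (w :: s) j] | j <- l]]); last first.
  by apply/setP=> f; rewrite !inE orbCA orbA.
apply: IH tts => //.
  move=> t' /flatten_mapP[t0 t0ts]; rewrite !mem_cat.
  by case/or3P=> h; apply: (partial_paint (tsE _ t0ts) h).
move=> j jl; rewrite in_setU1 negb_or lE ?inE ?jl ?orbT // andbT.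
have ji : j != i by apply: contraNneq il => <-.
have /andP[j0 js] := allP l_s _ jl; have /andP[i0 i_s'] := i_s.
(* Two of the new edges coincide only if their positions agree or if one of them joins [w] to
   itself, which needs position 0. *)
apply/eqP => /eq_set2[[_]|[_]]; move/eqP.
  by rewrite nth_uniq //= (negPf ji).
by rewrite -[X in _ == X]/(nth w (w :: s) 0) nth_uniq //= -leqn0 leqNgt j0.
Qed.

Lemma mem_mask_or (A : eqType) (k : bitseq) (s : seq A) x : size k = size s ->
  x \in s -> (x \in mask k s) || (x \in mask (map negb k) s).
Proof.
elim: k s => [|b k IH] [|y s] //= [/IH {}IH]; rewrite inE => /orP[/eqP-> | /IH].
  by case: b; rewrite /= mem_head ?orbT.
by case: b; rewrite /= !inE => /orP[]->; rewrite ?orbT.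
Qed.

(** Every component met the old boundary, so testing the labels along [t] controls the components of
    all of [P]. *)
Lemma partial_forget P E s k t t' : size k = size s ->
  partial P E s t -> t' \in forget k t -> partial P E (mask k s) t'.
Proof.
move=> sk [Tr [C [M [g [[-> EE dis] gok gS3 [acy lab] anc]]]]].
rewrite /forget -!map_mask; case: ifP => // /andP[aS3 fin]; rewrite inE => /eqP ->.
exists Tr, C, M, g; split => //.
  move=> v vP vk; case: (boolP (v \in s)) => vs; last exact: gS3.
  have := mem_mask_or sk vs; rewrite (negPf vk) /= => vn.
  move: aS3; rewrite all_map => /allP /(_ _ vn) /=.
  by case: (g v).1.
(* If no vertex is kept, all labels along [s] agree, and therefore all labels on [P] do. *)
move: fin; case: nilP => [/(congr1 size)|_].
  rewrite size_map => /size0nil k0 cst; left; split => // x y xP yP.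
  case: anc => [[_]|anc]; first exact.
  case/(constantP 0): cst => n; rewrite -map_comp => ltab.
  have ln v : v \in P -> (g v).2 = n.
    by move/anc; rewrite -[X in _ \in X]/(map (snd \o g) s) ltab => /nseqP[].
  by rewrite (ln x) ?(ln y).
rewrite all_map => /allP h; case: anc => [[s0 cP]|anc].
  by left; split => //; rewrite s0; case: (k).
right=> v /anc /mapP[x xs ->]; have /hasP[y /mapP[z zs ->] /= /eqP <-] := h _ xs.
by apply/mapP; exists z.
Qed.

Lemma rearrange_perm (x0 : T) s p : perm_eq p (iota 0 (size s)) -> perm_eq (rearrange x0 s p) s.
Proof. by move=> ps; rewrite -[X in perm_eq _ X](mkseq_nth x0 s) perm_map. Qed.

Lemma rearrange_map (A : Type) (x0 : T) (d : A) (f : T -> A) s p :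
  perm_eq p (iota 0 (size s)) -> rearrange d (map f s) p = map f (rearrange x0 s p).
Proof.
move=> ps; rewrite /rearrange -map_comp; apply/eq_in_map => i /=.
by rewrite (perm_mem ps) mem_iota => /andP[_ si]; rewrite (nth_map x0).
Qed.

Lemma partial_rearrange x0 P E s t p : perm_eq p (iota 0 (size s)) ->
  partial P E s t -> partial P E (rearrange x0 s p) (rearrange dflt t p).
Proof.
move=> ps [Tr [C [M [g [[-> EE dis] gok gS3 [acy lab] anc]]]]].
have sp := rearrange_perm x0 ps.
exists Tr, C, M, g; split => //.
- by rewrite (rearrange_map x0).
- by move=> v vP; rewrite (perm_mem sp); apply: gS3.
- case: anc => [[s0 cP]|anc]; [left|right].
    by split => //; apply: size0nil; rewrite (perm_size sp) s0.
  by move=> v /anc; rewrite (perm_mem (perm_map (fun x => (g x).2) sp)).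
Qed.

(** Taking the index loses nothing: every label used on [P] occurs along [s], unless [s] is empty
    and there is a single label. *)
Lemma partial_canon P E s t : partial P E s t -> partial P E s (canon t).
Proof.
case=> Tr [C [M [g [[-> EE dis] gok gS3 [acy lab] anc]]]].
pose l := [seq (g x).2 | x <- s].
have mapl : [seq p.2 | p <- map g s] = l by rewrite -map_comp.
exists Tr, C, M, (fun v => ((g v).1, index (g v).2 l)); split => //.
- by rewrite /canon mapl -map_comp.
- split => // x y xP yP /=; rewrite lab //.
  case: anc => [[_ cP]|anc]; first by rewrite (cP x y) // !eqxx.
  by apply/eqP/eqP => [->//|/(congr1 (nth 0 l))]; rewrite !nth_index ?anc.
- case: anc => [[s0 cP]|anc]; [left|right]; first by split=> // x y xP yP; rewrite (cP x y).
  by move=> v /anc /mapP[x xs ex]; apply/mapP; exists x; rewrite //= ex.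
Qed.

(** The same edge sets serve, since a weaker status accepts every triple that the stronger one
    accepts. *)
Lemma partial_weaken P E s t u : uniq s -> weaker t u -> partial P E s u -> partial P E s t.
Proof.
move=> us + [Tr [C [M [g [[uE EE dis] gok gS3 [acy lab] anc]]]]].
rewrite /weaker all2E uE size_map => /andP[/eqP st wk].
have wks v : v \in s -> weaker_status (nth dflt t (index v s)).1 (g v).1 &&
                        ((nth dflt t (index v s)).2 == (g v).2).
  move=> vs; have iv : index v s < size s by rewrite index_mem.
  have /= := all_nthP (dflt, dflt) wk (index v s).
  rewrite size_zip st size_map minnn => /(_ iv).
  by rewrite nth_zip ?size_map // (nth_map v) ?nth_index.
exists Tr, C, M, (fun v => (if v \in s then (nth dflt t (index v s)).1 else (g v).1, (g v).2)).
split => //.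
- split => //; apply: (@eq_from_nth _ dflt) => [|i]; rewrite st ?size_map // => si.
  have x0 : T by case: (s) si.
  rewrite (nth_map x0) // mem_nth // index_uniq //.
  have := wks (nth x0 s i); rewrite mem_nth // index_uniq // => /(_ isT)/andP[_ /eqP<-].
  by case: nth.
- move=> v vP /=; case: ifP => [/wks/andP[+ _]|_]; last exact: gok.
  by move/weaker_status_ok; apply; apply: gok.
- by move=> v vP vs /=; rewrite (negPf vs) gS3.
Qed.

(** Status [S3] at every vertex forces cycle degree 0 or 2 and matching degree at most 1; an empty
    boundary forces a connected tree. *)
Lemma partial_three_decomposition (e : rel T) t :
  partial setT (edges e) [::] t -> three_decomposition e.
Proof.
case=> Tr [C [M [g [[_ EE dis] gok gS3 [acy lab] anc]]]].
have S3ok v : status_ok S3 (degE Tr v) (degE C v) (degE M v).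
  by rewrite -(gS3 v) ?in_setT ?gok.
exists Tr, C, M; split => //.
- split => //; first by rewrite -EE -setUA subsetUl.
  move=> x y; rewrite lab ?in_setT //.
  by case: anc => [[_ cP]|/(_ x (in_setT x)) //]; rewrite (cP x y) ?in_setT.
- split; first by rewrite -EE -setUA setUCA subsetUl.
  by move=> v; move: (S3ok v); case: (degE C v) (degE Tr v) (degE M v) => [|[|[|?]]] [|[|[|[|?]]]] [|?]; auto.
- split; first by rewrite -EE subsetUr.
  by move=> v; move: (S3ok v); case: (degE C v) (degE Tr v) (degE M v) => [|[|[|?]]] [|[|[|[|?]]]] [|[|?]].
Qed.

End Partial.

(** * Boundaries of initial segments *)

Section Boundary.
Variables (T : finType) (e : rel T).
Implicit Types (P Q : {set T}) (s : seq T).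

Definition outside P v := [set w | e v w & w \notin P].
Definition boundary P := [set v in P | outside P v != set0].
Definition inner P := [set f in edges e | f \subset P].

Lemma mem_inner P f : (f \in inner P) = (f \in edges e) && (f \subset P).
Proof. by rewrite inE. Qed.

Lemma boundaryP P v : reflect (v \in P /\ exists2 w, e v w & w \notin P) (v \in boundary P).
Proof.
rewrite inE; apply: (iffP andP) => [[-> /set0Pn[w]]|[-> [w vw wP]]].
  by rewrite inE => /andP[]; split => //; exists w.
by split => //; apply/set0Pn; exists w; rewrite inE vw.
Qed.

(** The sequence [s] may repeat vertices or list members of [P]; thus it need not change when [P]
    grows. *)
Definition sweepable P := exists s : seq T,
  (forall v, (v \in P) || (v \in s)) /\
  forall i, #|boundary (P :|: [set x in take i s])| <= 4.

(** Vertices are ordered by the first bag containing them. The boundary of an initial segment,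
    together with the next vertex, fits into the first bag of that vertex, which leaves at most four
    for the boundary. *)
Lemma sweepable0 : pathwidth_le e 4 -> sweepable set0.
Proof.
case=> B [vB eB iB] szB.
pose f v := find (fun X : {set T} => v \in X) B.
have f_size v : f v < size B by rewrite -has_find; apply/hasP; apply: vB.
have f_in v : v \in nth set0 B (f v).
  by move: (f_size v); rewrite -has_find => /(nth_find set0).
have f_le v j : v \in nth set0 B j -> f v <= j.
  move=> vj; rewrite leqNgt; apply/negP=> /(before_find set0) /=; by rewrite vj.
pose le_f := relpre f leq.
have le_f_tr : transitive le_f by move=> a b c; apply: leq_trans.
have le_f_tot : total le_f by move=> a b; apply: leq_total.
pose s := sort le_f (enum T); have us : uniq s by rewrite sort_uniq enum_uniq.
have ss : sorted le_f s by apply: sort_sorted.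
have in_s v : v \in s by rewrite mem_sort mem_enum.
exists s; split => [v|i]; first by rewrite in_s orbT.
rewrite set0U; set Q := [set x in take i s].
have [si|is_] := leqP (size s) i.
  rewrite (_ : boundary Q = set0) ?cards0 //; apply/setP=> v; rewrite in_set0.
  by apply/negP=> /boundaryP[_ [w _]]; rewrite inE take_oversize ?in_s.
have [w0 _] : exists w0 : T, true by case: (s) is_ => // w0 _; exists w0.
set w := nth w0 s i.
have wQ : w \notin Q by rewrite inE in_take ?in_s // index_uniq // ltnn.
have ord a b : index a s <= index b s -> f a <= f b.
  move=> ab; rewrite -[a](nth_index w0 (in_s a)) -[b](nth_index w0 (in_s b)).
  by apply: (sorted_leq_nth le_f_tr (fun x => leqnn _) w0 ss); rewrite ?inE ?index_mem.
have iw : index w s = i by rewrite index_uniq.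
(* A boundary vertex [u] shares a bag [j] with a later neighbour [z]. Since
   [f u <= f w <= f z <= j], the bag [f w] lies between two bags containing [u]. *)
have sub : w |: boundary Q \subset nth set0 B (f w).
  apply/subsetP=> u; rewrite in_setU1 => /orP[/eqP-> //|/boundaryP[]].
  rewrite inE in_take ?in_s // => ui [z /eB[X /(nthP set0)[j jB <-] /andP[uj zj]]].
  rewrite inE in_take ?in_s // -leqNgt => iz.
  have fuw : f u <= f w by apply: ord; rewrite iw ltnW.
  have fwj : f w <= j by apply: leq_trans (f_le _ _ zj); apply: ord; rewrite iw.
  move: fuw; rewrite leq_eqVlt => /orP[/eqP <- //|fuw].
  move: fwj; rewrite leq_eqVlt => /orP[/eqP -> //|fwj].
  by apply: (subsetP (iB _ _ _ fuw fwj jB)); rewrite inE f_in.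
have := subset_leq_card sub; rewrite cardsU1 (_ : w \notin boundary Q) ?add1n; last first.
  by apply: contra wQ => /boundaryP[].
by move/leq_trans/(_ (szB _ (mem_nth set0 (f_size w)))).
Qed.

(** In any later segment that misses [w], the vertex [u] is on the boundary only because of [w].
    Adding [w] removes [u] and contributes at most [w] itself. *)
Lemma sweepable_forced P u w :
  u \in P -> outside P u = [set w] -> sweepable P -> sweepable (w |: P).
Proof.
move=> uP uw [s [cov bd]]; exists s; split => [v|i].
  by rewrite in_setU1 -orbA cov orbT.
have := bd i; rewrite -setUA; set Q := P :|: _ => bdQ.
have /andP[euw wP] : e u w && (w \notin P) by have := set11 w; rewrite -uw inE.
have [wQ|wQ] := boolP (w \in Q).
  by rewrite (setUidPr _) // sub1set.
have uQ : u \in Q by rewrite inE uP.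
have ubd : u \in boundary Q by apply/boundaryP; split => //; exists w.
apply: leq_trans bdQ; rewrite (cardsD1 u (boundary Q)) ubd add1n.
apply: leq_trans (_ : #|w |: (boundary Q :\ u)| <= _); last first.
  by rewrite cardsU1 -add1n leq_add2r leq_b1.
apply/subset_leq_card/subsetP=> v /boundaryP[]; rewrite !in_setU1 => /orP[-> //|vQ] [z vz].
rewrite in_setU1 negb_or => /andP[zw zQ]; apply/orP; right.
rewrite in_setD1; apply/andP; split; last by apply/boundaryP; split => //; exists z.
apply: contraNneq zw => vu; rewrite vu in vz.
have : z \in outside P u by rewrite inE vz; apply: contra zQ => zP; rewrite inE zP.
by rewrite uw inE.
Qed.

(** The choice is the first vertex of [s] outside [P]; a shorter prefix of [s] lies in [P], and a
    longer one already contains [w]. *)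
Lemma sweepable_next P : P != setT -> sweepable P -> exists2 w, w \notin P & sweepable (w |: P).
Proof.
move=> PT [s [cov bd]].
have [w0 w0P] : exists w0, w0 \notin P.
  by apply/existsP; rewrite -negb_forall; apply: contra PT => /forallP h; apply/eqP/setP=> x; rewrite h inE.
have hs : has (fun x => x \notin P) s.
  by apply/hasP; exists w0 => //; move: (cov w0); rewrite (negPf w0P).
set k := find (fun x => x \notin P) s; set w := nth w0 s k.
have ks : k < size s by rewrite -has_find.
exists w; first exact: (nth_find w0 hs).
exists s; split => [v|i]; first by rewrite in_setU1 -orbA cov orbT.
have [ki|ik] := ltnP k i.
  rewrite (_ : _ :|: _ = P :|: [set x in take i s]) ?bd //.
  rewrite -setUA; apply/setUidPr; rewrite sub1set !inE; apply/orP; right.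
  by rewrite /w -(nth_take w0 ki) mem_nth // size_take; case: ifP.
have sub j : j <= k -> [set x in take j s] \subset P.
  move=> jk; apply/subsetP=> x; rewrite inE => /(nthP w0)[a ja <-].
  move: ja; rewrite size_take_min leq_min => /andP[aj as_]; rewrite nth_take //.
  by have /negbFE := before_find w0 (leq_trans aj jk).
rewrite (setUidPl _); last by apply: subset_trans (sub _ ik) (subsetU1 _ _).
have := bd k.+1; rewrite (take_nth w0 ks) (_ : P :|: _ = w |: P) //.
apply/setP=> x; rewrite !inE mem_rcons inE orbCA; congr (_ || _).
by case: (boolP (x \in take k s)) => xt; rewrite ?orbF ?orbT // (subsetP (sub k _)) ?inE.
Qed.

(** A vertex of [P] off the boundary would be separated from the outside of [P] by fewer than three
    vertices. *)
Lemma small_boundary P : k_connected 3 e -> P != setT -> #|boundary P| < 3 -> P \subset boundary P.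
Proof.
case=> _ conn PT bd3; apply/subsetP=> x xP; apply: contraNT PT => xbd.
apply/eqP/setP=> y; rewrite in_setT; apply/negbNE/negP=> yP.
have ybd : y \notin boundary P by apply: contra yP => /boundaryP[].
have /connectP[p] := conn _ bd3 x y xbd ybd.
(* A walk that starts in [P] and avoids the boundary can never leave [P]. *)
elim: p x xP xbd => [|z p IH] x xP xbd /=; first by move=> _ yx; rewrite yx xP in yP.
case/andP=> /andP[/andP[xz _] zbd]; apply: IH => //.
by apply: contraR xbd => zP; apply/boundaryP; split => //; exists z.
Qed.

End Boundary.

Lemma mem_masks m : m \in masks (size m).
Proof.
by elim: m => //= -[] m IH; rewrite mem_cat; apply/orP; [right|left]; apply: map_f.
Qed.

(** * Adding one vertex to the segment *)

Section Step.
Variables (T : finType) (e : rel T).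
Hypotheses (e_sym : symmetric e) (e_irr : irreflexive e) (e_cubic : cubic e).
Implicit Types (P : {set T}) (s : seq T).

(** A single ordering [s] of the boundary has to serve all profiles of the state. *)
Definition realizes P (st : state) := exists s,
  [/\ uniq s, s =i boundary e P, st.1 = [seq #|outside e P v| | v <- s], ~~ nilp st.2 &
      forall t, t \in st.2 -> partial P (inner e P) s t].

Variables (P : {set T}) (w : T) (s : seq T).
Hypotheses (wP : w \notin P) (us : uniq s) (sbd : s =i boundary e P).
Let sig := [seq #|outside e P v| | v <- s].
Let m := map (e w) s.

Let sP : {subset s <= P}.
Proof. by move=> v; rewrite sbd => /boundaryP[]. Qed.

Let ws : w \notin s.
Proof. by apply: contra wP => /sP. Qed.

Let uws : uniq (w :: s).
Proof. by rewrite /= ws. Qed.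

Let nbrs u : e w u -> u \in P -> u \in s.
Proof. by move=> wu uP; rewrite sbd; apply/boundaryP; split=> //; exists w; rewrite // e_sym. Qed.

(** Neighbours of [w] inside [P] have [w] outside [P], so all of them lie on the boundary and are
    counted by the mask. *)
Lemma count_nbrs : count id m + #|outside e (w |: P) w| = 3.
Proof.
rewrite -(e_cubic w) -(cardsID P [set u | e w u]) count_map -size_filter; congr (_ + _).
  rewrite -(card_uniqP (filter_uniq _ us)); apply: eq_card => u.
  rewrite mem_filter !inE; case: (boolP (e w u)) => //= wu.
  by apply/idP/idP => [/sP|/(nbrs wu)].
apply: eq_card => u; rewrite !inE negb_or andbC; case: (eqVneq u w) => [->|//].
by rewrite e_irr !andbF.
Qed.

Lemma new_sigE : new_sig sig m = [seq #|outside e (w |: P) v| | v <- w :: s].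
Proof.
rewrite /new_sig /=; congr (_ :: _); first by rewrite -count_nbrs addKn.
rewrite /sig /m zip_map -map_comp; apply/eq_in_map=> u us' /=.
rewrite (cardsD1 w) inE wP andbT e_sym addKn; apply: eq_card => v.
by rewrite !inE negb_or andbCA.
Qed.

Let bd' : mask (kept sig m) (w :: s) = [seq v <- w :: s | 0 < #|outside e (w |: P) v|].
Proof. by rewrite /kept new_sigE -map_comp filter_mask. Qed.

(** Besides [w], no vertex enters the boundary: a neighbour outside [w |: P] is also outside [P]. *)
Lemma step_boundary : mask (kept sig m) (w :: s) =i boundary e (w |: P).
Proof.
move=> v; rewrite bd' mem_filter [RHS]inE in_setU1 card_gt0 andbC in_cons.
case: (eqVneq v w) => //= vw; apply/andP/andP=> [[/sP]|[vP]] //.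
case/set0Pn=> u; rewrite inE in_setU1 negb_or => /andP[vu uwP]; have /andP[_ uP] := uwP; split.
  by rewrite sbd; apply/boundaryP; split => //; exists u.
by apply/set0Pn; exists u; rewrite inE in_setU1 negb_or vu uwP.
Qed.

Lemma step_sigE : step_sig sig m = [seq #|outside e (w |: P) v| | v <- mask (kept sig m) (w :: s)].
Proof. by rewrite /step_sig new_sigE map_mask. Qed.

Lemma positionsE (A : Type) (x : A) (l : seq A) (b : bitseq) : size b = size l ->
  [seq nth x (x :: l) i | i <- positions b] = mask b l.
Proof.
move=> sb; rewrite /positions sb map_mask; congr (mask _ _).
by rewrite -[1]addn0 iotaDl -map_comp -[RHS](mkseq_nth x).
Qed.

Lemma inner_setU1 :
  inner e (w |: P) = inner e P :|: [set f in [seq [set w; nth w (w :: s) i] | i <- positions m]].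
Proof.
rewrite (map_comp (fun u => [set w; u]) (nth w (w :: s))) positionsE ?size_map // -filter_mask.
apply/setP=> f; rewrite in_setU !mem_inner [f \in [set _ | _]]inE.
apply/andP/orP.
  case=> fe fP; have [wf|wf] := boolP (w \in f); last first.
    left; rewrite fe; apply/subsetP=> v vf; move/subsetP/(_ v vf): fP.
    by rewrite in_setU1 => /orP[/eqP vw|//]; rewrite vw (negPf wf) in vf.
  right; case/imsetP: fe wf fP => -[a b]; rewrite inE /= => ab ->.
  (* An edge at [w] inside the new segment ends in a marked boundary vertex; [side] serves both
     orientations of the edge. *)
  have side c : e w c -> [set w; c] \subset w |: P ->
      [set w; c] \in [seq [set w; u] | u <- s & e w u].
    move=> wc; rewrite subUset => /andP[_]; rewrite sub1set in_setU1 => /orP[/eqP cw|cP].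
      by rewrite cw e_irr in wc.
    by apply/mapP; exists c => //; rewrite mem_filter wc nbrs.
  rewrite inE => /orP[]; rewrite inE => /eqP wE; rewrite -wE in ab *; first exact: side.
  by rewrite set2C; apply: side; rewrite e_sym.
case=> [/andP[fe fP]|/mapP[u]]; first by split => //; apply: subset_trans fP (subsetU1 _ _).
rewrite mem_filter => /andP[wu us'] ->; split.
  by apply/imsetP; exists (w, u); rewrite ?inE.
by apply/subsetP=> v; rewrite !inE => /orP[->//|/eqP->]; rewrite sP ?orbT.
Qed.

Lemma step_partial (ts : seq profile) : (s = [::] -> P = set0) ->
  (forall t, t \in ts -> partial P (inner e P) s t) ->
  forall t, t \in step sig ts m ->
  partial (w |: P) (inner e (w |: P)) (mask (kept sig m) (w :: s)) t.
Proof.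
move=> s0 tsP t /flatten_mapP[t0 t0ts]; apply: partial_forget.
  by rewrite /kept new_sigE !size_map.
have wsP : {subset w :: s <= w |: P}.
  by move=> v; rewrite in_setU1 inE => /orP[->//|/sP->]; rewrite orbT.
rewrite inner_setU1; apply: partial_paint_all t0ts => //.
- move=> t1 /mapP[t2 /tsP pt ->]; apply: partial_fresh => // f.
  by rewrite inE => /andP[].
- by rewrite mask_uniq ?iota_uniq.
- apply/allP=> i /mem_mask; rewrite mem_iota add1n ltnS size_map => /andP[-> //].
(* The painted edges contain [w], so none of them lies inside [P]. *)
- move=> i _; rewrite inE negb_and; apply/orP; right.
  by apply/negP=> /subsetP/(_ w (set21 _ _)); rewrite (negPf wP).
Qed.

End Step.

(** * Running the automaton through the whole graph *)

Lemma table_closed j : j < size table ->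
  exists hints, closed_state table (nth ([::], [::]) table j) hints.
Proof.
move=> jt; have /andP[_ /all_nthP] := check_tableT.
have st : size table = size [seq p.2 | p <- table_data] by rewrite !size_map.
move=> /(_ (([::], [::]), String.EmptyString) j); rewrite size_zip -st minnn => /(_ jt).
by rewrite nth_zip // => cl; eexists; apply: cl.
Qed.

Section Main.
Variables (T : finType) (e : rel T).
Hypotheses (e_sym : symmetric e) (e_irr : irreflexive e) (e_cubic : cubic e) (conn : k_connected 3 e).
Implicit Types (P : {set T}) (s : seq T).

Lemma realizes0 : realizes e set0 ([::], [:: [::]]).
Proof.
exists [::]; split => //.
  by move=> v; rewrite in_nil; apply/esym/negP=> /boundaryP[]; rewrite inE.
move=> t; rewrite inE => /eqP ->.
exists set0, set0, set0, (fun _ => (S0, 0)); split => //.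
- split => //; last by rewrite !disjoints_subset !sub0set.
  apply/setP=> f; rewrite !setU0 mem_inner in_set0 subset0.
  apply/esym/negP=> /andP[/imsetP[p _ ->] /eqP/setP/(_ p.1)].
  by rewrite !inE eqxx.
- by move=> v; rewrite inE.
- by move=> v; rewrite inE.
- split; last by move=> x y; rewrite inE.
  case=> -[|x [|y s]] [_ //= _ /andP[]].
  by rewrite /adjE inE andbF.
- by left; split => // x y; rewrite inE.
Qed.

(** The decompositions stay fixed: the boundary is reordered by [p], labels are normalized, and
    statuses are weakened. *)
Lemma realizes_covers (x0 : T) P sig ts st p s :
  uniq s -> s =i boundary e P -> sig = [seq #|outside e P v| | v <- s] ->
  (forall t, t \in ts -> partial P (inner e P) s t) ->
  covers st sig ts p -> realizes e P st.
Proof.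
move=> us sbd sigE tsP /and4P[nst pp /eqP stE /allP ok].
rewrite sigE size_map in pp; have sp := rearrange_perm x0 pp.
exists (rearrange x0 s p); split.
- by rewrite (perm_uniq sp).
- by move=> v; rewrite (perm_mem sp).
- by rewrite stE sigE (rearrange_map x0).
- exact: nst.
- move=> t /ok /hasP[_ /mapP[u /tsP uP ->] tu].
  apply: (partial_weaken _ tu); first by rewrite (perm_uniq sp).
  exact/partial_canon/partial_rearrange.
Qed.

(** If the first boundary vertex has a single neighbour left, [sweepable_forced] permits taking it;
    otherwise the sweep order supplies [w] and the implication is vacuous. *)
Lemma next_vertex P s : s =i boundary e P -> P != setT -> sweepable e P ->
  exists w, [/\ w \notin P, sweepable e (w |: P) &
    (head 0 [seq #|outside e P v| | v <- s] == 1) ==> head false (map (e w) s)].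
Proof.
move=> sbd PT swP; case: s sbd => [|u s] sbd /=.
  by have [w] := sweepable_next PT swP; exists w.
have [/cards1P[w uw]|_] := boolP (_ == 1); last first.
  by have [w] := sweepable_next PT swP; exists w.
have uP : u \in P by have := mem_head u s; rewrite sbd => /boundaryP[].
have := set11 w; rewrite -uw inE => /andP[euw wP]; exists w; split => //.
  exact: sweepable_forced uP uw swP.
by rewrite e_sym euw.
Qed.

(** Induction on the number of vertices outside [P]. *)
Lemma three_decomposition_from P j : sweepable e P ->
  realizes e P (nth ([::], [::]) table j) -> three_decomposition e.
Proof.
have [n] := ubnP #|~: P|; elim: n P j => // n IH P j Pn swP [s [us sbd sigE ne tsP]].
set st := nth _ table j in sigE tsP ne.
have [PT|PT] := eqVneq P setT.
  (* At the end the boundary is empty and any stored profile gives a decomposition. *)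
  case tsE: st.2 ne => [//|t ts] _.
  have := tsP t; rewrite tsE mem_head => /(_ isT).
  have -> : s = [::].
    case: s sbd {us sigE tsP} => // u s /(_ u); rewrite mem_head PT => /esym/boundaryP[_ [w _]].
    by rewrite in_setT.
  have -> : inner e P = edges e by apply/setP=> f; rewrite mem_inner PT subsetT andbT.
  by rewrite PT; apply: partial_three_decomposition.
(* Beyond the table the default state has no profile, which [ne] excludes. *)
have jt : j < size table.
  by rewrite ltnNge; apply: contra ne => jt; rewrite /st nth_default.
have [w [wP swP' hd]] := next_vertex sbd PT swP.
have s0 : s = [::] -> P = set0.
  move=> s0; apply/eqP; rewrite -subset0; apply: subset_trans (small_boundary conn PT _) _.
    by rewrite (eq_card (B := pred0)) ?card0 // => v; rewrite -sbd s0.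
  by apply/subsetP=> v; rewrite -sbd s0.
set m := map (e w) s.
have szm : size m = size st.1 by rewrite sigE !size_map.
have step_s := step_boundary e_sym e_irr e_cubic wP us sbd.
have sigE' := step_sigE e_sym e_irr e_cubic wP us sbd.
have stepP := step_partial e_sym e_irr e_cubic wP us sbd s0 tsP.
rewrite -sigE -/m in step_s sigE' stepP.
have us' : uniq (mask (kept st.1 m) (w :: s)).
  by rewrite mask_uniq //= us andbT; apply: contra wP; rewrite sbd => /boundaryP[].
have kE : size (step_sig st.1 m) = #|boundary e (w |: P)|.
  by rewrite sigE' size_map -(card_uniqP us'); apply: eq_card.
(* The actual mask must be one of those for which the table was checked. *)
have pos : possible st.1 m.
  have cnt := count_nbrs e_sym e_irr e_cubic wP us sbd.
  rewrite -sigE -/m in hd; rewrite /possible kE hd -[X in _ <= X]cnt leq_addr /=.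
  have -> : #|boundary e (w |: P)| <= 4.
    by case: swP' => s1 [_ /(_ 0)]; rewrite take0 setU0.
  case: (ltnP 2) => [|bd2] /=; rewrite ?orbT // orbF.
  have [P'T|P'T] := eqVneq (w |: P) setT.
    apply/orP; left; rewrite cards_eq0; apply/eqP/setP=> v; rewrite in_set0.
    by apply/negP=> /boundaryP[_ [z _]]; rewrite P'T in_setT.
  (* With a boundary this small no vertex of [w |: P] is complete, hence none of [P] was before, and
     the boundary has grown by exactly [w]. *)
  have P'bd := small_boundary conn P'T bd2.
  have -> : boundary e (w |: P) = w |: P.
    by apply/eqP; rewrite eqEsubset P'bd andbT; apply/subsetP=> v /boundaryP[].
  rewrite cardsU1 wP add1n eqSS -szm size_map -(card_uniqP us).
  apply/orP; right; apply/eqP/eq_card => v; rewrite sbd; apply/idP/boundaryP=> [vP|[]//].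
  have /boundaryP[_ [z vz]] := subsetP P'bd v (setU1r w vP).
  by rewrite in_setU1 negb_or => /andP[_ zP]; split=> //; exists z.
have [hints /andP[/eqP sz /all_nthP cl]] := table_closed jt.
have mms : m \in [seq b <- masks (size st.1) | possible st.1 b].
  by rewrite mem_filter pos -szm mem_masks.
(* The hint for [m] stands at the index of [m] among the possible masks. *)
have := cl ([::], (0, [::])) (index m [seq b <- masks (size st.1) | possible st.1 b]).
rewrite size_zip -sz minnn index_mem => /(_ mms).
rewrite nth_zip // nth_index //= => cov.
apply: (IH (w |: P)) (realizes_covers w us' step_s sigE' stepP cov) => //.
rewrite -ltnS (leq_trans _ Pn) // ltnS; apply: proper_card.
by rewrite properC; apply: properUr; rewrite sub1set.
Qed.

End Main.

Theorem theorem6 (T : finType) (e : rel T) :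
  simple_graph e -> k_connected 3 e -> cubic e -> pathwidth_eq e 4 ->
  three_decomposition e.
Proof.
case=> e_sym e_irr conn e_cubic [/sweepable0 sw _].
have hd : nth ([::], [::]) table 0 = ([::], [:: [::]]).
  by have /andP[/eqP] := check_tableT; rewrite nth0.
apply: (three_decomposition_from e_sym e_irr e_cubic conn (j := 0) sw).
by rewrite hd; apply: realizes0.
Qed.
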